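(* Let $T$ be a tree with $n$ vertices. Then for every $1\leq j\leq n$, \[ I_j(T,X)=\left\langle\, d(\mathcal{M},X)\;\middle|\; \mathcal{M}\in \mathcal{V}_2^*(T^\ell,j)\right\rangle\subseteq\mathbb{Z}[X_T]. \]
   Context: A tree is a simple connected graph without cycles. For a graph $G$ with vertex set $V$, let $X_G=\{x_u\mid u\in V\}$ be indeterminates and let the generalized Laplacian $L(G,X_G)$ be the $V\times V$ matrix with $L_{u,u}=x_u$ and $L_{u,v}=-m_{uv}$ for $u\neq v$, where $m_{uv}$ is the number of edges between $u$ and $v$. The $j$-critical ideal $I_j(G,X_G)$ is the ideal of $\mathbb{Z}[X_G]$ generated by all $j\times j$ minors of $L(G,X_G)$. A $2$-matching of a graph (loops allowed) is a set $\mathcal{M}$ of edges such that every vertex is incident to at most two edges of $\mathcal{M}$, where a loop $vv$ counts twice as incident to $v$ but counts as one edge of $\mathcal{M}$; $|\mathcal{M}|$ is its number of edges. $T^\ell$ denotes the graph obtained from $T$ by adding one loop at each vertex. For a $2$-matching $\mathcal{M}$ of $T^\ell$, $\ell(\mathcal{M})$ is the set of loops in $\mathcal{M}$. $\mathcal{V}_2(T^\ell,j)$ is the set of $2$-matchings of $T^\ell$ of size $j$. A $2$-matching $\mathcal{M}$ of $T^\ell$ is minimal if there is no $2$-matching $\mathcal{M}'$ of $T^\ell$ with $|\mathcal{M}'|=|\mathcal{M}|$ and $\ell(\mathcal{M}')\subsetneq\ell(\mathcal{M})$; $\mathcal{V}_2^*(T^\ell,j)$ is the set of minimal $2$-matchings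 of $T^\ell$ of size $j$. Each connected component of a $2$-matching $\mathcal{M}$ of $T^\ell$ is either a single loop $uu$ or a path of $T$. Orient each path component (in either direction) as $w_1w_2\cdots w_{m+1}$ and set its heads to be $\{w_2,\dots,w_{m+1}\}$ and tails $\{w_1,\dots,w_m\}$; a loop $uu$ has head and tail $u$. Let $h(\mathcal{M})$, $t(\mathcal{M})$ be the unions of heads and of tails over all components (each has $|\mathcal{M}|$ elements). Then $d(\mathcal{M},X)=\pm\det L(T,X)[h(\mathcal{M}),t(\mathcal{M})]$ (rows $h(\mathcal{M})$, columns $t(\mathcal{M})$), with the sign chosen so that the leading coefficient (with respect to the degree lexicographic monomial order) is positive. *)

(* Defs.v *)
From HB Require Import structures.
From mathcomp Require Import all_boot all_order all_algebra.
From mathcomp Require Import mpoly.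
Set Implicit Arguments. Unset Strict Implicit. Unset Printing Implicit Defensive.
Import Order.TTheory GRing.Theory Num.Theory.
Local Open Scope ring_scope.

Definition has_cycle n (e : rel 'I_n) : Prop :=
  exists (x : 'I_n) (p : seq 'I_n),
    (2 <= size p)%N /\ uniq (x :: p) /\ path e x p /\ e (last x p) x.

Definition is_tree n (e : rel 'I_n) : Prop :=
  ssrbool.symmetric e /\ irreflexive e /\ (forall u v, connect e u v) /\ ~ has_cycle e.

(* Generalized Laplacian L(T,X) over Z[X_T] = {mpoly int[n]}; simple graph, so m_uv = e u v. *)
Definition gen_laplacian n (e : rel 'I_n) : 'M[{mpoly int[n]}]_n :=
  \matrix_(u, v) (if u == v then 'X_u else - ((e u v : nat)%:R)).

Definition in_ideal (R : comRingType) (S : R -> Prop) (p : R) : Prop :=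
  exists s : seq (R * R), (forall x, x \in s -> S x.2) /\
    p = \sum_(x <- s) x.1 * x.2.

Definition minor_gen (R : comRingType) n (A : 'M[R]_n) (j : nat) (p : R) : Prop :=
  exists (f g : 'I_j -> 'I_n),
    {homo f : a b / (a < b)%N} /\ {homo g : a b / (a < b)%N} /\
    p = \det (\matrix_(a, b) A (f a) (g b)).

Definition critical_ideal n (e : rel 'I_n) (j : nat) : {mpoly int[n]} -> Prop :=
  in_ideal (minor_gen (gen_laplacian e) j).

(* 2-matchings of T^l: a set of loops (given by their vertices) and a set of
   tree edges (each an unordered pair [set u; v] with e u v). *)
Definition matching n := ({set 'I_n} * {set {set 'I_n}})%type.

Definition tree_edges n (e : rel 'I_n) : {set {set 'I_n}} :=
  [set [set u; v] | u in 'I_n, v in 'I_n & e u v].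

Definition is_2matching n (e : rel 'I_n) (M : matching n) : Prop :=
  M.2 \subset tree_edges e /\
  forall v : 'I_n, ((v \in M.1 : nat).*2 + #|[set E in M.2 | v \in E]| <= 2)%N.

Definition msize n (M : matching n) : nat := (#|M.1| + #|M.2|)%N.

Definition is_min_2matching n (e : rel 'I_n) (j : nat) (M : matching n) : Prop :=
  is_2matching e M /\ msize M = j /\
  ~ exists M' : matching n,
      is_2matching e M' /\ msize M' = msize M /\ M'.1 \proper M.1.

(* An orientation of the path components of M: a set A of arcs such that each
   edge of M gets exactly one direction, and every vertex has in- and
   out-degree at most 1 (so each path w_1...w_{m+1} is oriented as a directed
   path, in one of its two directions). *)
Definition is_orientation n (M : matching n) (A : {set 'I_n * 'I_n}) : Prop :=
  (forall u v, (u, v) \in A -> [set u; v] \in M.2) /\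
  (forall u v, [set u; v] \in M.2 -> ((u, v) \in A) != ((v, u) \in A)) /\
  (forall v, #|[set u | (u, v) \in A]| <= 1)%N /\
  (forall v, #|[set w | (v, w) \in A]| <= 1)%N.

Definition heads n (M : matching n) (A : {set 'I_n * 'I_n}) : {set 'I_n} :=
  M.1 :|: [set v | [exists u, (u, v) \in A]].
Definition tails n (M : matching n) (A : {set 'I_n * 'I_n}) : {set 'I_n} :=
  M.1 :|: [set u | [exists v, (u, v) \in A]].

(* det A[Rw, Cl], rows of Rw and columns of Cl in increasing order
   (meaningful when #|Rw| = #|Cl|). *)
Definition subdet (R : comRingType) n (A : 'M[R]_n) (Rw Cl : {set 'I_n}) : R :=
  \det (\matrix_(a < #|Rw|, b < #|Rw|)
          A (enum_val a) (nth (enum_val a) (enum Cl) b)).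

(* d(M,X) = +- det L[h(M), t(M)], sign making the leading coefficient
   (w.r.t. mpoly's degree-lexicographic order) positive. *)
Definition dpoly n (e : rel 'I_n) (M : matching n) (A : {set 'I_n * 'I_n})
  : {mpoly int[n]} :=
  let D := subdet (gen_laplacian e) (heads M A) (tails M A) in
  if 0 <= mleadc D then D else - D.

(* Main.v *)
(** In a tree, vertex-disjoint paths joining given sources to given sinks are
    determined by their endpoints. Hence a nonzero minor L[R, C] has a single
    surviving system of paths, and it equals, up to sign, the principal minor on
    the remaining vertices W, which are the loops of a 2-matching with j edges.
    In particular d(M, X) is the principal minor on the loops of M, whatever the
    orientation.

    It remains to reduce to minimal 2-matchings. If a 2-matching of size j with
    loops W is not minimal, exchanging edges branch by branch with one that has
    fewer loops produces a vertex u of W and a linear forest Q avoiding W - u,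
    with one more edge than before, in which u has degree at most 1. Then both
    W - u and W - u - v (v in W adjacent to u, with uv added to Q) are loop sets
    of 2-matchings with at least j edges, and expanding the principal minor on W
    along row u,
      det L[W] = x_u det L[W - u] - sum_v det L[W - u - v],
    gives the claim by induction on the size of W. *)
Require Import Defs.
From HB Require Import structures.
From mathcomp Require Import all_boot all_order all_algebra.
From mathcomp Require Import perm mpoly zify.
From Stdlib Require Classical_Prop.
Set Implicit Arguments. Unset Strict Implicit. Unset Printing Implicit Defensive.
Import Order.TTheory GRing.Theory.
Local Open Scope nat_scope.

(** * Branches of a tree at a vertex *)

Definition off n (e : rel 'I_n) (v : 'I_n) : rel 'I_n :=
  [rel x y | [&& e x y, x != v & y != v]].

(** For [b != v] this is the vertex set of the component of [b] in the tree minus [v]; for [b = v]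
    it degenerates to the singleton of [v]. *)
Definition branch n (e : rel 'I_n) (v b : 'I_n) : {set 'I_n} :=
  [set x | connect (off e v) b x].

Lemma branch_refl n (e : rel 'I_n) v b : b \in branch e v b.
Proof. by rewrite inE connect0. Qed.

Lemma branch_step n (e : rel 'I_n) v b x y :
  x \in branch e v b -> off e v x y -> y \in branch e v b.
Proof. by rewrite !inE => bx xy; apply: connect_trans bx (connect1 xy). Qed.

Lemma branch_sub n (e : rel 'I_n) v b (K : {set 'I_n}) :
  b \in K -> (forall x y, x \in K -> off e v x y -> y \in K) ->
  branch e v b \subset K.
Proof.
move=> bK closedK; apply/subsetP => x; rewrite inE => /connectP[p + ->].
elim: p b bK => //= y p IHp b bK /andP[by_ pth].
exact: IHp (closedK _ _ bK by_) pth.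
Qed.

Lemma branch_neq n (e : rel 'I_n) v b x :
  b != v -> x \in branch e v b -> x != v.
Proof.
move=> bv /(subsetP (branch_sub (K := [set~ v]) _ _)); rewrite !inE; apply => //.
by move=> ? y _ /and3P[_ _]; rewrite !inE.
Qed.

Lemma tree_sym n (e : rel 'I_n) : is_tree e -> ssrbool.symmetric e.
Proof. by case. Qed.

Lemma tree_neq n (e : rel 'I_n) u v : is_tree e -> e u v -> u != v.
Proof. by case=> _ [irr _]; case: eqP => // -> ; rewrite irr. Qed.

(** Two distinct neighbours of [v] in one branch would be joined by a simple path avoiding [v],
    which closes up through [v] to a cycle. *)
Lemma tree_branch_inj n (e : rel 'I_n) v b c :
  is_tree e -> e v b -> e v c -> c \in branch e v b -> b = c.
Proof.
move=> He evb evc cb; apply/eqP; case: (eqVneq b c) => // bc.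
have bv : b != v by rewrite eq_sym (tree_neq He evb).
case: (He) => [syme [_ [_ nocyc]]]; case: nocyc.
move: cb; rewrite inE => /connectP[p0 pth0 lastp0].
move: lastp0; case/shortenP: pth0 => p pth uniqp _ defc.
have offp : all (fun x => x != v) p.
  elim: p b {uniqp defc evb bc bv} pth => //= y p IHp b.
  by move=> /andP[/and3P[_ _ ->]] /IHp.
exists v, (b :: p); split.
  by case: p defc {offp uniqp pth} => //= cb; rewrite cb eqxx in bc.
split; first by rewrite cons_uniq uniqp andbT inE negb_or eq_sym bv;
  apply/negP => /(allP offp); rewrite eqxx.
split; last by rewrite /= -defc syme.
rewrite /= evb; apply: sub_path pth => x y /and3P[].
by [].
Qed.

Lemma tree_edgesP n (e : rel 'I_n) (E : {set 'I_n}) :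
  reflect (exists u v, e u v /\ E = [set u; v]) (E \in tree_edges e).
Proof.
apply: (iffP imset2P) => [[u v _]|[u [v [euv ->]]]].
  by rewrite inE => euv ->; exists u, v.
by exists u v; rewrite ?inE.
Qed.

Lemma tree_edge_at n (e : rel 'I_n) (E : {set 'I_n}) x :
  is_tree e -> E \in tree_edges e -> x \in E -> exists2 y, e x y & E = [set x; y].
Proof.
move=> He /tree_edgesP[u [v [euv ->]]]; rewrite !inE => /orP[] /eqP->.
  by exists v.
by exists u; rewrite 1?(tree_sym He) // setUC.
Qed.

Lemma edge_in_tree n (e : rel 'I_n) x y :
  is_tree e -> [set x; y] \in tree_edges e -> e x y.
Proof.
move=> He /tree_edgesP[u [v [euv Exy]]].
have := tree_neq He euv.
have : u \in [set x; y] by rewrite Exy !inE eqxx.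
have : v \in [set x; y] by rewrite Exy !inE eqxx orbT.
rewrite !inE => /orP[] /eqP hv /orP[] /eqP hu; move: euv; rewrite hu hv ?eqxx //.
by rewrite (tree_sym He).
Qed.

(** An edge can leave the branch only through [v], and by [tree_branch_inj] the only vertex of the
    branch adjacent to [v] is [b]. *)
Lemma edge_branch n (e : rel 'I_n) v b (E : {set 'I_n}) x :
  is_tree e -> e v b -> E \in tree_edges e -> x \in E -> x \in branch e v b ->
  E \subset branch e v b \/ E = [set v; b].
Proof.
move=> He evb ET xE xD; have [y exy ->] := tree_edge_at He ET xE.
have bv : b != v by rewrite eq_sym (tree_neq He evb).
have xv := branch_neq bv xD.
have [yv|yv] := eqVneq y v.
  right; rewrite yv setUC; congr [set _; _].
  by apply/esym/(tree_branch_inj He evb) => //; rewrite (tree_sym He) -yv.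
left; apply/subsetP => z; rewrite in_set2 => /orP[] /eqP-> //.
by apply: branch_step xD _; rewrite /off /= exy xv.
Qed.

(** * Degrees and linear forests *)

Definition deg n (P : {set {set 'I_n}}) (x : 'I_n) := #|[set E in P | x \in E]|.

Definition linear_forest n (e : rel 'I_n) (W : {set 'I_n}) (P : {set {set 'I_n}}) :=
  [/\ P \subset tree_edges e, forall x, deg P x <= 2
    & forall E, E \in P -> E \subset ~: W].

Lemma deg_eq0 n (P : {set {set 'I_n}}) x :
  (deg P x == 0) = [forall E in P, x \notin E].
Proof.
rewrite cards_eq0; apply/eqP/forall_inP => [P0 E EP|xP].
  by apply/negP => xE; have := in_set0 E; rewrite -P0 inE EP xE.
by apply/setP => E; rewrite !inE; apply/andP => -[/xP/negP].
Qed.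

Lemma deg_sub n (P Q : {set {set 'I_n}}) x :
  (forall E, E \in P -> x \in E -> E \in Q) -> deg P x <= deg Q x.
Proof.
by move=> PQ; apply/subset_leq_card/subsetP => E; rewrite !inE => /andP[/PQ EQ xE];
  rewrite EQ.
Qed.

(** A loop exhausts both units of degree at its vertex, so the edges of a 2-matching form a linear
    forest avoiding the looped vertices. *)
Lemma is_2matchingE n (e : rel 'I_n) (M : matching n) :
  is_2matching e M <-> linear_forest e M.1 M.2.
Proof.
case: M => W P; rewrite /is_2matching /linear_forest /=; split.
  case=> PT dP; split=> // [x|E EP]; first exact: leq_trans (leq_addl _ _) (dP x).
  apply/subsetP => x xE; rewrite inE; apply/negP => xW.
  have := dP x; rewrite xW /= => d0.
  have : deg P x == 0 by rewrite -leqn0 -(leq_add2l 2).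
  by rewrite deg_eq0 => /forall_inP/(_ _ EP); rewrite xE.
case=> PT dP PW; split=> // x; have [xW /=|_ /=] := boolP (x \in W); last exact: dP.
have -> : #|[set E in P | x \in E]| = 0; last by [].
apply/eqP; rewrite -/(deg P x) deg_eq0; apply/forall_inP => E EP.
by apply/negP => xE; have := subsetP (PW _ EP) _ xE; rewrite inE xW.
Qed.

Lemma linear_forest_sub n (e : rel 'I_n) (W : {set 'I_n}) (P Q : {set {set 'I_n}}) :
  Q \subset P -> linear_forest e W P -> linear_forest e W Q.
Proof.
move=> QP [PT dP PW]; split; first exact: subset_trans QP PT.
  by move=> x; apply: leq_trans (deg_sub _) (dP x) => E /(subsetP QP).
by move=> E /(subsetP QP)/PW.
Qed.

(** * Exchanging edges between two linear forests *)

Definition swap n (D : {set 'I_n}) (P1 P2 : {set {set 'I_n}}) :=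
  [set E in P1 | ~~ (E \subset D)] :|: [set E in P2 | E \subset D].

Lemma in_swap n (D E : {set 'I_n}) (P1 P2 : {set {set 'I_n}}) :
  (E \in swap D P1 P2) =
  (E \in P1) && ~~ (E \subset D) || (E \in P2) && (E \subset D).
Proof. by rewrite !inE. Qed.

Lemma card_swap n (D : {set 'I_n}) (P1 P2 : {set {set 'I_n}}) :
  #|swap D P1 P2| + #|[set E in P1 | E \subset D]| =
  #|P1| + #|[set E in P2 | E \subset D]|.
Proof.
rewrite /swap cardsU disjoint_setI0 ?cards0 ?subn0; last first.
  by rewrite disjoints_subset; apply/subsetP => E; rewrite !inE => /andP[_ /negPf->];
    rewrite andbF.
rewrite -(cardsID [set E : {set 'I_n} | E \subset D] P1).
have -> : P1 :&: [set E : {set 'I_n} | E \subset D] = [set E in P1 | E \subset D].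
  by apply/setP => E; rewrite !inE.
have -> : P1 :\: [set E : {set 'I_n} | E \subset D] = [set E in P1 | ~~ (E \subset D)].
  by apply/setP => E; rewrite !inE andbC.
by rewrite addnC addnA.
Qed.

Lemma swap_out n (D E : {set 'I_n}) (P1 P2 : {set {set 'I_n}}) x :
  E \in swap D P1 P2 -> x \in E -> x \notin D -> E \in P1.
Proof.
by rewrite in_swap => /orP[/andP[] //|/andP[_ ED] xE]; rewrite (subsetP ED _ xE).
Qed.

(** The only tree edge crossing the boundary of the branch is [[set v; b]]. When [P1] lacks it, each
    vertex of the branch inherits its edges from [P2], and by [swap_out] each vertex outside
    inherits them from [P1]; degrees thus stay at most 2. *)
Lemma swap_in n (e : rel 'I_n) v b (E : {set 'I_n}) (P1 P2 : {set {set 'I_n}}) x :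
  is_tree e -> e v b -> P1 \subset tree_edges e -> [set v; b] \notin P1 ->
  E \in swap (branch e v b) P1 P2 -> x \in E -> x \in branch e v b -> E \in P2.
Proof.
move=> He evb PT vbP; rewrite in_swap => /orP[/andP[EP ED] xE xD|/andP[] //].
have [ED'|Evb] := edge_branch He evb (subsetP PT _ EP) xE xD.
  by rewrite ED' in ED.
by rewrite -Evb EP in vbP.
Qed.

Lemma swap_sub n (D : {set 'I_n}) (P1 P2 T : {set {set 'I_n}}) :
  P1 \subset T -> P2 \subset T -> swap D P1 P2 \subset T.
Proof.
move=> P1T P2T; apply/subsetP => E; rewrite in_swap.
by case/orP=> /andP[EP _]; [apply: (subsetP P1T) | apply: (subsetP P2T)].
Qed.

Lemma deg_setU1 n (E : {set 'I_n}) (P : {set {set 'I_n}}) x :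
  deg (E |: P) x <= (x \in E) + deg P x.
Proof.
apply: leq_trans (_ : #|[set F in [set E] | x \in F]| + deg P x <= _).
  rewrite /deg -cardsUI -[leqLHS]addn0; apply: leq_add => //.
  by apply/subset_leq_card/subsetP => F; rewrite !inE andb_orl.
rewrite leq_add2r; case: (boolP (x \in E)) => [xE|/negPf xE] /=.
  by rewrite -(cards1 E); apply/subset_leq_card/subsetP => F; rewrite inE => /andP[].
rewrite leqn0 cards_eq0; apply/eqP/setP => F; rewrite !inE.
by case: eqP => // ->; rewrite xE.
Qed.

Lemma linear_forest_deg0 n (e : rel 'I_n) (W : {set 'I_n}) P x :
  linear_forest e W P -> x \in W -> deg P x = 0.
Proof.
case=> _ _ PW xW; apply/eqP; rewrite deg_eq0; apply/forall_inP => E EP.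
by apply/negP => xE; have := subsetP (PW _ EP) _ xE; rewrite inE xW.
Qed.

Lemma linear_forest_avoid n (e : rel 'I_n) (W : {set 'I_n}) P E x :
  linear_forest e W P -> E \in P -> x \in E -> x \notin W.
Proof. by case=> _ _ PW /PW/subsetP EW /EW; rewrite inE. Qed.

Lemma linear_forest_setS n (e : rel 'I_n) (W W' : {set 'I_n}) P :
  W' \subset W -> linear_forest e W P -> linear_forest e W' P.
Proof.
move=> W'W [PT dP PW]; split=> // E EP; apply: subset_trans (PW _ EP) _.
by rewrite setCS.
Qed.

(** Compare the numbers of edges of [P] and [P'] inside the branch [D]. If [P'] has at least as
    many, transplanting its part into [P] and adding the edge [vb] gains an edge. Otherwise
    transplanting the part of [P] into [P'] pays for the removal of [vb], which lowers the degree at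
    [v]. The hypothesis on [D] makes the edges of [P'] inside [D] avoid [W]. *)
Lemma exchange_step n (e : rel 'I_n) (W W' : {set 'I_n}) v b P P' :
  is_tree e -> W' \subset W -> v \in W -> e v b ->
  (forall x, x \in branch e v b -> x \in W -> x \in W') ->
  linear_forest e W P -> linear_forest e W' P' -> [set v; b] \in P' ->
  (exists Q, [/\ linear_forest e (W :\ v) Q, deg Q v <= 1 & #|P| < #|Q|]) \/
  (exists P'', [/\ linear_forest e W' P'', #|P'| <= #|P''| & deg P'' v < deg P' v]).
Proof.
move=> He W'W vW evb DW lfP lfP' vbP'; set D := branch e v b in DW.
have bv : b != v by rewrite eq_sym (tree_neq He evb).
have vD : v \notin D by apply/negP => /(branch_neq bv); rewrite eqxx.
have bD : b \in D := branch_refl e v b.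
have vbP : [set v; b] \notin P.
  by apply/negP => /(linear_forest_avoid lfP)/(_ (set21 v b)); rewrite vW.
have [PT dP PW] := lfP; have [P'T dP' P'W] := lfP'.
have [le01|lt10] := leqP #|[set E in P | E \subset D]| #|[set E in P' | E \subset D]|.
  left; pose S := swap D P P'; exists ([set v; b] |: S).
  have dSv : deg S v = 0.
    apply/eqP; rewrite -leqn0 -(linear_forest_deg0 lfP vW).
    by apply: deg_sub => E ES vE; apply: swap_out ES vE vD.
  have vbS : [set v; b] \notin S.
    by apply: contra vbP => /swap_out; apply; [apply: set21 | apply: vD].
  have dQv : deg ([set v; b] |: S) v <= 1.
    by apply: leq_trans (deg_setU1 _ _ _) _; rewrite dSv set21.
  split=> //; last first.
    rewrite cardsU1 vbS add1n ltnS -(leq_add2r #|[set E in P | E \subset D]|).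
    by rewrite card_swap leq_add2l.
  split=> [|x|E].
  - by rewrite subUset sub1set (subsetP P'T) ?swap_sub.
  - have [->|xv] := eqVneq x v; first exact: leq_trans dQv _.
    (* Inside [D] all edges of the new forest, including [vb], come from [P']; at the vertices
       outside [D] other than [v] they come from [P]. *)
    have [xD|xD] := boolP (x \in D).
      apply: leq_trans (dP' x); apply: deg_sub => E.
      by rewrite in_setU1 => /orP[/eqP-> //|ES xE]; apply: (swap_in He evb PT vbP ES xE xD).
    apply: leq_trans (dP x); apply: deg_sub => E.
    rewrite in_setU1 => /orP[/eqP->|ES xE]; last exact: swap_out ES xE xD.
    by rewrite in_set2 (negPf xv) /= => /eqP xb; rewrite xb bD in xD.
  - rewrite in_setU1 => EQ; apply/subsetP => x xE; rewrite !inE.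
    have [//|xv /=] := eqVneq x v; apply/negP => xW.
    case/orP: EQ => [/eqP EvB|].
      move: (xE); rewrite EvB in_set2 (negPf xv) /= => /eqP xb.
      have xD : x \in D by rewrite xb.
      rewrite EvB in xE.
      by have := linear_forest_avoid lfP' vbP' xE; rewrite DW.
    rewrite in_swap => /orP[/andP[EP _]|/andP[EP' ED]].
      by have := linear_forest_avoid lfP EP xE; rewrite xW.
    by have := linear_forest_avoid lfP' EP' xE; rewrite (DW x) ?(subsetP ED).
right; pose P1 := P' :\ [set v; b]; exists (swap D P1 P).
have vbP1 : [set v; b] \notin P1 by rewrite !inE eqxx.
have P1P' : P1 \subset P' := subsetDl _ _.
have P1T : P1 \subset tree_edges e := subset_trans P1P' P'T.
split.
- split=> [|x|E]; first exact: swap_sub.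
  + have [xD|xD] := boolP (x \in D).
      by apply: leq_trans (dP x); apply: deg_sub => E ES xE;
        apply: (swap_in He evb P1T vbP1 ES xE xD).
    apply: leq_trans (dP' x); apply: deg_sub => E ES xE.
    by have /(subsetP P1P') := swap_out ES xE xD.
  + rewrite in_swap => /orP[/andP[/(subsetP P1P')/P'W] //|/andP[/PW EW _]].
    by apply: subset_trans EW _; rewrite setCS.
(* The branch gains at least one edge from [P], which makes up for the deleted edge [vb]. *)
- rewrite -(leq_add2r #|[set E in P1 | E \subset D]|) card_swap.
  rewrite (cardsD1 [set v; b] P') vbP' -/P1 addnAC addnC leq_add2l add1n.
  apply: leq_ltn_trans lt10; apply/subset_leq_card/subsetP => E.
  by rewrite inE => /andP[EP1 ED]; rewrite inE (subsetP P1P' _ EP1).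
- rewrite [ltnRHS](cardsD1 [set v; b]) inE vbP' set21 add1n ltnS.
  apply/subset_leq_card/subsetP => E; rewrite inE => /andP[ES vE].
  have := swap_out ES vE vD; rewrite in_setD1 => /andP[EvB EP'].
  by rewrite in_setD1 EvB inE EP'.
Qed.

(** Repeat [exchange_step] at each edge of [P'] from [v] to a vertex outside [B]; the degree of [v]
    drops each time. The branch beyond such an edge is disjoint from [B], so [W] and [W'] agree on
    it. *)
Lemma exchange_outside n (e : rel 'I_n) (W W' B : {set 'I_n}) v P P' :
  is_tree e -> W' \subset W -> v \in W ->
  (forall x y, x \in B -> off e v x y -> y \in B) ->
  (W :\: W') :\ v \subset B ->
  linear_forest e W P -> linear_forest e W' P' ->
  (exists Q, [/\ linear_forest e (W :\ v) Q, deg Q v <= 1 & #|P| < #|Q|]) \/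
  (exists P'', [/\ linear_forest e W' P'', #|P'| <= #|P''|
    & forall y, [set v; y] \in P'' -> y \in B]).
Proof.
move=> He W'W vW closedB WB lfP.
have [k] := ubnP (deg P' v); elim: k P' => // k IHk P' ltk lfP'.
have [/existsP[b /andP[vbP' bB]]|] := boolP [exists b, ([set v; b] \in P') && (b \notin B)];
  last first.
  move=> /existsPn noB; right; exists P'; split=> // y vyP'.
  by have := noB y; rewrite vyP' negbK.
have evb : e v b by case: lfP' => P'T _ _; apply: edge_in_tree (subsetP P'T _ vbP').
have bv : b != v by rewrite eq_sym (tree_neq He evb).
have DB x : x \in branch e v b -> x \notin B.
  move=> /(subsetP (branch_sub (K := ~: B) _ _)); rewrite !inE; apply=> // y z.
  rewrite !inE => yB /and3P[eyz yv zv]; apply: contra yB => zB.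
  by apply: closedB zB _; rewrite /off /= (tree_sym He) eyz yv zv.
have DW x : x \in branch e v b -> x \in W -> x \in W'.
  move=> xD xW; apply: contraNT (DB x xD) => xW'; apply: (subsetP WB).
  by rewrite !inE xW xW' (branch_neq bv xD).
have [?|[P1 [lfP1 leP1 ltP1]]] := exchange_step He W'W vW evb DW lfP lfP' vbP'.
  by left.
have [?|[P2 [lfP2 leP2 P2B]]] := IHk P1 (leq_trans ltP1 ltk) lfP1; first by left.
by right; exists P2; split=> //; apply: leq_trans leP2.
Qed.

(* [B] is the component of [r] in the tree minus [v]; it is largest when no
   element of [U] other than [v] lies beyond [v] as seen from [r]. *)
Lemma outermost_vertex n (e : rel 'I_n) (U : {set 'I_n}) r :
  is_tree e -> r \in U ->
  exists v (B : {set 'I_n}), [/\ v \in U, forall x y, x \in B -> off e v x y -> y \in B,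
    forall x y, x \in B -> y \in B -> e v x -> e v y -> x = y & U :\ v \subset B].
Proof.
move=> He rU; pose B (v : 'I_n) : {set 'I_n} := branch e v r :\ v.
have offP v x y : off e v x y = [&& e x y, x != v & y != v] by [].
have symoff v : ssrbool.symmetric (off e v).
  by move=> x y; rewrite !offP (tree_sym He) andbCA [_ && (x != v)]andbC andbCA.
have closedB v x y : x \in B v -> off e v x y -> y \in B v.
  by rewrite !in_setD1 => /andP[_ xb] xy; rewrite (branch_step xb xy) andbT;
    case/and3P: xy.
pose v := [arg max_(v > r | v \in U) #|B v|].
have [vU maxv] : v \in U /\ forall u, u \in U -> #|B u| <= #|B v|.
  by rewrite /v; case: arg_maxnP.
exists v, (B v); split=> // [|x y|].
- exact: closedB.
- rewrite !in_setD1 !inE => /andP[_ rx] /andP[_ ry] evx evy.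
  apply: (tree_branch_inj He evx evy); rewrite inE.
  by apply: connect_trans ry; rewrite (sym_connect_sym (symoff v)).
apply/subsetP => u; rewrite in_setD1 => /andP[uv uU].
(* If some [u] of [U] other than [v] lay outside [B v], then [B u] would contain both [B v] and [v],
   contradicting the choice of [v]. *)
apply: contraLR (maxv u uU) => uB; rewrite -ltnNge.
have ur : r != u \/ r = v.
  have [|] := eqVneq r v; first by right.
  by move=> rv; left; apply: contraNneq uB => <-; rewrite in_setD1 rv branch_refl.
have ru : r != u by case: ur => // ->; rewrite eq_sym.
have rBu : r \in B u by rewrite in_setD1 ru branch_refl.
have BvBu : B v \subset B u.
  (* When [r = v] the set [B v] is empty. *)
  have [rv|rv] := eqVneq r v.
    have bv1 : branch e v v \subset [set v].
      apply: branch_sub => [|y z]; rewrite ?inE // offP => /eqP->.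
      by rewrite eqxx andbF.
    apply/subsetP => x; rewrite in_setD1 rv => /andP[xv /(subsetP bv1)].
    by rewrite inE (negPf xv).
  apply: subset_trans (_ : B v :&: B u \subset B u); last exact: subsetIr.
  apply: subset_trans (subsetDl _ _) _; apply: branch_sub => [|y z].
    by rewrite inE rBu in_setD1 rv branch_refl.
  rewrite !in_setI => /andP[yBv yBu] yz.
  have zBv := closedB _ _ _ yBv yz; rewrite zBv /=.
  apply: closedB yBu _; rewrite offP; case/and3P: yz => -> _ _ /=.
  by apply/andP; split; apply: contraNneq uB => <-.
apply: proper_card; apply/properP; split=> //; exists v; last by rewrite !inE eqxx.
have [->|rv] := eqVneq v r; first exact: rBu.
have [_ [_ [conn _]]] := He.
(* If [v] were not in [B u], no edge would lead from [B v] to [v], so [B v] would be closed under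
   all tree edges and [r] could not be connected to [v]. *)
apply: contraTT (conn r v) => vBu; apply/negP => rv_conn.
have sub p : forall z, z \in B v -> path e z p -> last z p \in B v.
  elim: p => //= y p IHp z zBv /andP[ezy]; apply: IHp.
  have zBu := subsetP BvBu _ zBv.
  have yv : y != v.
    apply: contraNneq vBu => yv; apply: (closedB _ z) => //.
    by rewrite offP -yv ezy yv (eq_sym v) uv andbT; case/setD1P: zBu.
  by apply: (closedB _ z) => //; rewrite offP ezy yv andbT; case/setD1P: zBv.
have /connectP[p pth vp] := rv_conn.
have : r \in B v by rewrite in_setD1 eq_sym rv branch_refl.
by move/sub/(_ pth); rewrite -vp in_setD1 eqxx.
Qed.

(** Induction on the number of vertices of [W] missing from [W']. After the exchanges at an
    outermost missing vertex [v], this vertex keeps at most one edge. If [v] is the only missing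
    vertex, it serves as [u]; otherwise that edge is dropped and [v] joins [W']. *)
Lemma augment n (e : rel 'I_n) (W W' : {set 'I_n}) P P' :
  is_tree e -> W' \proper W -> linear_forest e W P -> linear_forest e W' P' ->
  #|P| + #|W :\: W'| <= #|P'| ->
  exists u Q, [/\ u \in W, linear_forest e (W :\ u) Q, deg Q u <= 1 & #|P| < #|Q|].
Proof.
move=> He; have [k] := ubnP #|W :\: W'|.
elim: k W' P' => // k IHk W' P' ltk /properP[W'W [r rW rW']] lfP lfP' leP.
have rU : r \in W :\: W' by rewrite inE rW rW'.
have [v [B [vU closedB uniqB UB]]] := outermost_vertex He rU.
have [vW vW'] := setDP vU.
have [[Q [lfQ dQ ltQ]]|[P2 [lfP2 leP2 P2B]]] :=
  exchange_outside He W'W vW closedB UB lfP lfP'.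
  by exists v, Q.
have P2T : P2 \subset tree_edges e by case: lfP2.
(* Every neighbour of [v] in [P2] lies in [B], which contains at most one neighbour of [v]. *)
have dP2 : deg P2 v <= 1.
  apply/card_le1_eqP => E F; rewrite !inE => /andP[EP2 vE] /andP[FP2 vF].
  have [y evy Ey] := tree_edge_at He (subsetP P2T _ EP2) vE.
  have [z evz Fz] := tree_edge_at He (subsetP P2T _ FP2) vF.
  rewrite Ey Fz; rewrite Ey in EP2; rewrite Fz in FP2.
  by rewrite (uniqB y z) // P2B.
rewrite (cardsD1 v) vU in ltk leP.
have [U0|[u uU]] := set_0Vmem ((W :\: W') :\ v).
  exists v, P2; split=> //; last by apply: leq_trans leP2; apply: leq_trans leP; lia.
  apply: linear_forest_setS lfP2; apply/subsetP => x; rewrite in_setD1 => /andP[xv xW].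
  by have := in_set0 x; rewrite -U0 !inE xv xW andbT /= => /negbFE.
have WU : W :\: (v |: W') = (W :\: W') :\ v.
  by apply/setP => x; rewrite !inE negb_or andbA.
(* Passing to [P3] costs at most one edge, while the set of missing vertices loses [v], so the
   inequality on cardinals persists. *)
pose P3 := [set E in P2 | v \notin E].
have cP3 : #|P2| = deg P2 v + #|P3|.
  rewrite -(cardsID [set E : {set 'I_n} | v \in E] P2); congr (_ + _).
    by apply: eq_card => E; rewrite !inE.
  by apply: eq_card => E; rewrite !inE andbC.
apply: (IHk (v |: W') P3) => //.
- by rewrite WU; lia.
- apply/properP; split; first by rewrite subUset sub1set vW.
  by move: uU; rewrite -WU => /setDP[uW uvW]; exists u.
- have [_ dP2' P2W] : linear_forest e W' P3.
    by apply: linear_forest_sub lfP2; apply/subsetP => E; rewrite inE => /andP[].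
  split=> // [|E EP3].
    by apply: subset_trans P2T; apply/subsetP => E; rewrite inE => /andP[].
  apply/subsetP => x xE; rewrite !inE negb_or; apply/andP; split.
    by apply: contraTneq EP3 => xv; rewrite inE -xv xE andbF.
  by have := subsetP (P2W _ EP3) _ xE; rewrite inE.
- by rewrite WU; lia.
Qed.

(** * Orientations of linear forests *)

(* The arcs [A] orient the paths of a 2-matching with loops [W]. *)
Definition arc_system n (e : rel 'I_n) (W : {set 'I_n}) (A : {set 'I_n * 'I_n}) :=
  [/\ forall u v, (u, v) \in A ->
        [/\ e u v, u \notin W, v \notin W & (v, u) \notin A],
      forall u u' v, (u, v) \in A -> (u', v) \in A -> u = u'
    & forall u v v', (u, v) \in A -> (u, v') \in A -> v = v'].

Lemma in_heads n (M : matching n) (A : {set 'I_n * 'I_n}) v :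
  reflect (v \in M.1 \/ exists u, (u, v) \in A) (v \in heads M A).
Proof.
rewrite !inE; apply: (iffP orP) => -[]; first by left.
- by case/existsP=> u uv; right; exists u.
- by left.
by case=> u uv; right; apply/existsP; exists u.
Qed.

Lemma in_tails n (M : matching n) (A : {set 'I_n * 'I_n}) u :
  reflect (u \in M.1 \/ exists v, (u, v) \in A) (u \in tails M A).
Proof.
rewrite !inE; apply: (iffP orP) => -[]; first by left.
- by case/existsP=> v uv; right; exists v.
- by left.
by case=> v uv; right; apply/existsP; exists v.
Qed.

Lemma set2_eq (T : finType) (a b c d : T) :
  [set a; b] = [set c; d] -> (a = c /\ b = d) \/ (a = d /\ b = c).
Proof.
move=> abcd; have : a \in [set c; d] by rewrite -abcd set21.
have : b \in [set c; d] by rewrite -abcd set22.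
have : c \in [set a; b] by rewrite abcd set21.
have : d \in [set a; b] by rewrite abcd set22.
rewrite !in_set2 => /orP[]/eqP h1 /orP[]/eqP h2 /orP[]/eqP h3 /orP[]/eqP h4;
  subst; by [left | right].
Qed.

Lemma orientation_arc_system n (e : rel 'I_n) (M : matching n) A :
  is_tree e -> is_2matching e M -> is_orientation M A -> arc_system e M.1 A.
Proof.
move=> He /is_2matchingE lfM [AM [orA [inA outA]]]; split.
- move=> u v uvA; have uvM := AM _ _ uvA.
  have [MT _ _] := lfM; split.
  + exact: edge_in_tree (subsetP MT _ uvM).
  + exact: linear_forest_avoid lfM uvM (set21 _ _).
  + exact: linear_forest_avoid lfM uvM (set22 _ _).
  + by have := orA _ _ uvM; rewrite uvA; case: (_ \in A).
- move=> u u' v uv u'v; have /card_le1_eqP := inA v; apply; rewrite inE //.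
- move=> u v v' uv uv'; have /card_le1_eqP := outA u; apply; rewrite inE //.
Qed.

Definition undirected n (A : {set 'I_n * 'I_n}) : {set {set 'I_n}} :=
  [set [set a.1; a.2] | a in A].

Lemma card_undirected n (e : rel 'I_n) W (A : {set 'I_n * 'I_n}) :
  arc_system e W A -> #|undirected A| = #|A|.
Proof.
case=> arcA _ _; apply: card_in_imset => -[a b] [c d] abA cdA /= /set2_eq[[-> ->] //|].
by case=> ac bd; move: cdA; rewrite -ac -bd => /(fun h => arcA _ _ h)[_ _ _]; rewrite abA.
Qed.

Lemma undirected_orientation n (e : rel 'I_n) (M : matching n) A :
  is_tree e -> is_2matching e M -> is_orientation M A -> undirected A = M.2.
Proof.
move=> He /is_2matchingE[MT _ _] [AM [orA _]].
apply/setP => E; apply/imsetP/idP => [[[a b] abA ->]|EM]; first exact: AM.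
have /tree_edgesP[u [v [euv Euv]]] := subsetP MT _ EM.
have := orA u v; rewrite -Euv => /(_ EM).
have [uvA _|_] := boolP ((u, v) \in A); first by exists (u, v).
by rewrite eq_sym eqbF_neg negbK => vuA; exists (v, u) => //=; rewrite setUC.
Qed.

(** An edge at [x] comes from an arc entering [x] or an arc leaving it, and there is at most one of
    each. *)
Lemma arc_system_forest n (e : rel 'I_n) W (A : {set 'I_n * 'I_n}) :
  is_tree e -> arc_system e W A -> linear_forest e W (undirected A).
Proof.
move=> He [arcA inA outA]; split.
- apply/subsetP => _ /imsetP[[u v] uvA ->]; apply/tree_edgesP; exists u, v.
  by have [] := arcA _ _ uvA.
- move=> x.
  pose I := [set a in A | a.2 == x]; pose O := [set a in A | a.1 == x].
  have cI : #|I| <= 1.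
    apply/card_le1_eqP => -[a b] [c d]; rewrite !inE /= => /andP[ab /eqP bx] /andP[cd /eqP dx].
    by subst; rewrite (inA _ _ _ ab cd).
  have cO : #|O| <= 1.
    apply/card_le1_eqP => -[a b] [c d]; rewrite !inE /= => /andP[ab /eqP bx] /andP[cd /eqP dx].
    by subst; rewrite (outA _ _ _ ab cd).
  apply: leq_trans (leq_add cI cO); apply: leq_trans (leq_card_setU I O).
  apply: leq_trans (leq_imset_card (fun a => [set a.1; a.2]) _).
  apply/subset_leq_card/subsetP => E; rewrite inE => /andP[/imsetP[[a b] abA ->]].
  rewrite in_set2 => xab; apply/imsetP; exists (a, b) => //.
  by rewrite !inE abA /= orbC ![_ == x]eq_sym.
- move=> _ /imsetP[[a b] abA ->]; have [_ aW bW _] := arcA _ _ abA.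
  by apply/subsetP => x; rewrite in_set2 inE => /orP[]/eqP->.
Qed.

Local Open Scope ring_scope.

(** * Ideals and equality up to sign *)

Lemma in_ideal0 (R : comNzRingType) (S : R -> Prop) : in_ideal S 0.
Proof. by exists [::]; rewrite big_nil. Qed.

Lemma in_ideal_gen (R : comNzRingType) (S : R -> Prop) p : S p -> in_ideal S p.
Proof.
move=> Sp; exists [:: (1, p)]; rewrite big_seq1 mul1r; split=> // x.
by rewrite inE => /eqP->.
Qed.

Lemma in_idealD (R : comNzRingType) (S : R -> Prop) p q :
  in_ideal S p -> in_ideal S q -> in_ideal S (p + q).
Proof.
case=> s [Ss ->] [t [St ->]]; exists (s ++ t); rewrite big_cat; split=> // x.
by rewrite mem_cat => /orP[/Ss|/St].
Qed.

Lemma in_idealM (R : comNzRingType) (S : R -> Prop) a p :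
  in_ideal S p -> in_ideal S (a * p).
Proof.
case=> s [Ss ->]; exists [seq (a * x.1, x.2) | x <- s]; split.
  by move=> _ /mapP[x xs ->]; apply: (Ss x).
by rewrite big_map mulr_sumr; apply: eq_bigr => x _; rewrite mulrA.
Qed.

Lemma in_ideal_sum (R : comNzRingType) (S : R -> Prop) (I : Type) (r : seq I)
    (P : pred I) (F : I -> R) :
  (forall i, P i -> in_ideal S (F i)) -> in_ideal S (\sum_(i <- r | P i) F i).
Proof.
by move=> SF; apply: big_ind => //; [apply: in_ideal0 | apply: in_idealD].
Qed.

Lemma in_ideal_trans (R : comNzRingType) (S S' : R -> Prop) p :
  (forall q, S q -> in_ideal S' q) -> in_ideal S p -> in_ideal S' p.
Proof.
move=> SS' [s [Ss ->]]; rewrite big_seq; apply: in_ideal_sum => x xs.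
by apply: in_idealM; apply: SS'; apply: (Ss x).
Qed.

Definition eq_sign (R : pzRingType) (x y : R) := exists k : nat, x = (-1) ^+ k * y.

Lemma eq_sign_sym (R : pzRingType) (x y : R) : eq_sign x y -> eq_sign y x.
Proof. by case=> k ->; exists k; rewrite signrMK. Qed.

Lemma eq_sign_trans (R : pzRingType) (x y z : R) :
  eq_sign x y -> eq_sign y z -> eq_sign x z.
Proof. by case=> k -> [l ->]; exists (k + l)%N; rewrite exprD mulrA. Qed.

Lemma in_ideal_sign (R : comNzRingType) (S : R -> Prop) p q :
  eq_sign p q -> in_ideal S q -> in_ideal S p.
Proof. by case=> k ->; apply: in_idealM. Qed.

(** * Minors of the generalized Laplacian *)

Definition minor n (e : rel 'I_n) j (f g : 'I_j -> 'I_n) : {mpoly int[n]} :=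
  \det (\matrix_(a, b) gen_laplacian e (f a) (g b)).

Definition principal n (e : rel 'I_n) (W : {set 'I_n}) : {mpoly int[n]} :=
  minor e (@enum_val _ (mem W)) (@enum_val _ (mem W)).

Lemma gen_laplacian_neq0 n (e : rel 'I_n) u v :
  gen_laplacian e u v != 0 -> u = v \/ e u v.
Proof.
rewrite mxE; case: (u =P v) => [|_]; first by left.
by case: (e u v); [right | rewrite mulr0n oppr0 eqxx].
Qed.

Lemma gen_laplacian_edge n (e : rel 'I_n) u v :
  is_tree e -> e u v -> gen_laplacian e u v = -1.
Proof. by move=> He euv; rewrite mxE (negPf (tree_neq He euv)) euv. Qed.

(** Since [minor] takes arbitrary index maps, precomposing with [lift] makes the cofactors [minor]s
    again, which suits induction on the size. *)
Lemma minor_expand n (e : rel 'I_n) j (f g : 'I_j -> 'I_n) i :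
  minor e f g = \sum_b gen_laplacian e (f i) (g b) *
    ((-1) ^+ (i + b) * minor e (f \o lift i) (g \o lift b)).
Proof.
rewrite /minor (expand_det_row _ i); apply: eq_bigr => b _; rewrite mxE.
congr (_ * (_ * \det _)); apply/matrixP => x y; rewrite !mxE /=.
by rewrite ?mxE.
Qed.

Lemma inj_same_image j (T : finType) (f f' : 'I_j -> T) :
  injective f' -> f @: 'I_j = f' @: 'I_j ->
  exists s : {perm 'I_j}, forall a, f (s a) = f' a.
Proof.
move=> inj' ff'.
have /fin_all_exists[h fh] a : exists b, f b = f' a.
  have : f' a \in f @: 'I_j by rewrite ff' imset_f.
  by case/imsetP=> b _ ->; exists b.
have injh : injective h by move=> a b hab; apply: inj'; rewrite -!fh hab.
by exists (perm injh) => a; rewrite permE.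
Qed.

(** Injective families with the same image differ by a permutation, so only the signatures of a row
    and a column permutation appear. *)
Lemma minor_reindex n (e : rel 'I_n) j (f f' g g' : 'I_j -> 'I_n) :
  injective f' -> injective g' -> f @: 'I_j = f' @: 'I_j -> g @: 'I_j = g' @: 'I_j ->
  eq_sign (minor e f' g') (minor e f g).
Proof.
move=> injf injg /(inj_same_image injf)[s fs] /(inj_same_image injg)[t gt].
exists (s + t)%N; rewrite exprD -mulrA.
have -> : minor e f' g' =
    \det (row_perm s (col_perm t (\matrix_(a, b) gen_laplacian e (f a) (g b)))).
  by congr (\det _); apply/matrixP => a b; rewrite !mxE fs gt.
by rewrite row_permE col_permE !det_mulmx !det_perm odd_permV [X in _ * X]mulrC.
Qed.

Lemma minor_principal n (e : rel 'I_n) (W : {set 'I_n}) j (f g : 'I_j -> 'I_n) :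
  injective f -> injective g -> f @: 'I_j = W -> g @: 'I_j = W ->
  eq_sign (minor e f g) (principal e W).
Proof.
move=> injf injg fW gW.
have cW : #|W| = j by rewrite -fW card_imset // card_ord.
subst j; have eW : (@enum_val _ (mem W)) @: 'I_#|W| = W.
  apply/setP => x; apply/imsetP/idP => [[a _ ->]|xW]; first exact: enum_valP.
  by exists (enum_rank_in xW x); rewrite ?enum_rankK_in.
by apply: minor_reindex => //; rewrite eW ?fW ?gW.
Qed.

Lemma imset_lift (T : finType) j (f : 'I_j -> T) i :
  injective f -> (f \o lift i) @: 'I_j.-1 = (f @: 'I_j) :\ f i.
Proof.
move=> injf; apply/setP => x; rewrite in_setD1; apply/imsetP/andP => [[a _ ->]|].
  by rewrite /= imset_f ?inE // (inj_eq injf) eq_sym neq_lift.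
case=> xi /imsetP[b _ xb].
have ib : i != b by apply: contraNneq xi => ->; rewrite xb.
by have [a ab _] := unlift_some ib; exists a => //=; rewrite -ab.
Qed.

Lemma inj_lift (T : finType) j (f : 'I_j -> T) i :
  injective f -> injective (f \o lift i).
Proof. by move=> injf; apply: inj_comp injf (@lift_inj _ i). Qed.

Lemma card_imset_setI (T : finType) j (f : 'I_j -> T) (B : {set T}) :
  injective f -> #|f @: 'I_j :&: B| = #|[set i | f i \in B]|.
Proof.
move=> injf; rewrite -(card_imset _ injf); apply: eq_card => x; rewrite inE.
apply/andP/imsetP => [[/imsetP[i _ ->] fB]|[i]].
  by exists i; rewrite ?inE.
by rewrite inE => fB ->; rewrite imset_f.
Qed.

(* A nonzero Leibniz term would be a bijection matching the rows in [B] with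
   the columns in [B]. *)
Lemma minor_block0 n (e : rel 'I_n) j (f g : 'I_j -> 'I_n) (B : {set 'I_n}) :
  injective f -> injective g ->
  (forall a b, gen_laplacian e (f a) (g b) != 0 -> (f a \in B) = (g b \in B)) ->
  #|f @: 'I_j :&: B| != #|g @: 'I_j :&: B| -> minor e f g = 0.
Proof.
move=> injf injg fgB; rewrite !card_imset_setI // => neB.
rewrite /minor /determinant big1 // => s _; apply/eqP; rewrite mulf_eq0.
apply/orP; right; apply: contraNT neB => /prodf_neq0 nz; apply/eqP.
rewrite -(card_preimset [set i | g i \in B] (@perm_inj _ s)).
by apply: eq_card => i; rewrite !inE; apply: fgB; have := nz i isT; rewrite mxE.
Qed.

(** * Minors and systems of disjoint paths *)

Lemma sink_exists n (e : rel 'I_n) W (A : {set 'I_n * 'I_n}) :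
  is_tree e -> arc_system e W A -> A != set0 ->
  exists c s, (c, s) \in A /\ forall t, (s, t) \notin A.
Proof.
move=> He [arcA _ _] /set0Pn[a0 a0A].
(* Take an arc whose head has the smallest branch as seen from its tail. An arc [(s, t)] continuing
   [(c, s)] would have a strictly smaller one, since that branch misses [s]. *)
pose F (a : 'I_n * 'I_n) := #|branch e a.1 a.2|.
case: (arg_minnP F a0A) => -[c s] csA minF; exists c, s; split=> // t.
apply/negP => stA; have [ecs _ _ scA] := arcA _ _ csA.
have [est _ _ _] := arcA _ _ stA.
have sc : s != c by rewrite eq_sym (tree_neq He ecs).
have ts : t != s by rewrite eq_sym (tree_neq He est).
have tc : t != c by apply: contraNneq scA => <-.
have cb : c \notin branch e s t.
  apply/negP => cb; have esc : e s c by rewrite (tree_sym He).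
  by rewrite (tree_branch_inj He est esc cb) eqxx in tc.
have := minF _ stA; apply/negP; rewrite -ltnNge /F /=; apply: proper_card.
apply/properP; split; last first.
  exists s; first exact: branch_refl.
  by apply/negP => /(branch_neq ts); rewrite eqxx.
suff /subset_trans : branch e s t \subset branch e s t :&: branch e c s.
  by apply; apply: subsetIr.
apply: branch_sub => [|x y].
  rewrite in_setI branch_refl; apply: branch_step (branch_refl _ _ _) _.
  by rewrite /off /= est sc tc.
rewrite !in_setI => /andP[xs xc] xy; have ys := branch_step xs xy; rewrite ys /=.
apply: branch_step xc _; case/and3P: xy => exy _ _; rewrite /off /= exy.
by apply/and3P; split=> //; apply: contraNneq cb => <-.
Qed.

(** Heads of arcs are never looped, and an arc is determined by its head. *)
Lemma card_heads_setI n (e : rel 'I_n) (M : matching n) (A : {set 'I_n * 'I_n}) B :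
  arc_system e M.1 A ->
  #|heads M A :&: B| = (#|M.1 :&: B| + #|[set a in A | a.2 \in B]|)%N.
Proof.
case=> arcA inA _; rewrite -[X in (_ + X)%N](card_in_imset (f := snd)); last first.
  move=> [a b] [c d]; rewrite !inE /= => /andP[ab _] /andP[cd _] bd; subst.
  by rewrite (inA _ _ _ ab cd).
rewrite -cardsUI [X in (_ + X)%N](_ : _ = 0%N) ?addn0.
  apply: eq_card => v; rewrite in_setI [in RHS]in_setU in_setI; apply/andP/orP.
    case=> /in_heads[vM|[u uv]] vB; [by left; rewrite vM|right].
    by apply/imsetP; exists (u, v); rewrite ?inE ?uv.
  case=> [/andP[vM ->]|/imsetP[[u w]]]; first by split=> //; apply/in_heads; left.
  rewrite inE /= => /andP[uw wB] ->; split=> //.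
  by apply/in_heads; right; exists u.
apply/eqP; rewrite cards_eq0; apply/eqP/setP => v; rewrite !inE.
apply/andP => -[/andP[vM _]] /imsetP[[u w]]; rewrite inE => /andP[uw _] /= vw.
by have [_ _] := arcA _ _ uw; rewrite -vw vM.
Qed.

Lemma card_tails_setI n (e : rel 'I_n) (M : matching n) (A : {set 'I_n * 'I_n}) B :
  arc_system e M.1 A ->
  #|tails M A :&: B| = (#|M.1 :&: B| + #|[set a in A | a.1 \in B]|)%N.
Proof.
case=> arcA _ outA; rewrite -[X in (_ + X)%N](card_in_imset (f := fst)); last first.
  move=> [a b] [c d]; rewrite !inE /= => /andP[ab _] /andP[cd _] bd; subst.
  by rewrite (outA _ _ _ ab cd).
rewrite -cardsUI [X in (_ + X)%N](_ : _ = 0%N) ?addn0.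
  apply: eq_card => v; rewrite in_setI [in RHS]in_setU in_setI; apply/andP/orP.
    case=> /in_tails[vM|[u uv]] vB; [by left; rewrite vM|right].
    by apply/imsetP; exists (v, u); rewrite ?inE ?uv.
  case=> [/andP[vM ->]|/imsetP[[w u]]]; first by split=> //; apply/in_tails; left.
  rewrite inE /= => /andP[uw wB] ->; split=> //.
  by apply/in_tails; right; exists u.
apply/eqP; rewrite cards_eq0; apply/eqP/setP => v; rewrite !inE.
apply/andP => -[/andP[vM _]] /imsetP[[w u]]; rewrite inE => /andP[uw _] /= vw.
by have [_] := arcA _ _ uw; rewrite -vw vM.
Qed.

Lemma card_heads n (e : rel 'I_n) (M : matching n) (A : {set 'I_n * 'I_n}) :
  arc_system e M.1 A -> #|heads M A| = (#|M.1| + #|A|)%N.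
Proof.
move=> /(card_heads_setI setT); rewrite !setIT => ->; congr (_ + _)%N.
by apply: eq_card => a; rewrite !inE andbT.
Qed.

Lemma card_tails n (e : rel 'I_n) (M : matching n) (A : {set 'I_n * 'I_n}) :
  arc_system e M.1 A -> #|tails M A| = (#|M.1| + #|A|)%N.
Proof.
move=> /(card_tails_setI setT); rewrite !setIT => ->; congr (_ + _)%N.
by apply: eq_card => a; rewrite !inE andbT.
Qed.

(* Row [s] of the minor meets the nonzero entries only at neighbours of [s].
   Counting rows and columns inside the branch of [c] at [s] kills every
   neighbour but [c]. *)
Lemma minor_arc_system n (e : rel 'I_n) (M : matching n) (A : {set 'I_n * 'I_n})
    j (f g : 'I_j -> 'I_n) :
  is_tree e -> arc_system e M.1 A -> injective f -> injective g ->
  f @: 'I_j = heads M A -> g @: 'I_j = tails M A ->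
  eq_sign (minor e f g) (principal e M.1).
Proof.
move=> He; have [k] := ubnP #|A|; elim: k A j f g => // k IHk A j f g ltk.
move=> arcA injf injg fA gA; have [A0|nA] := eqVneq A set0.
  apply: minor_principal => //; rewrite ?fA ?gA A0.
    by apply/setP => x; apply/in_heads/idP => [[//|[u]]|]; [rewrite inE | left].
  by apply/setP => x; apply/in_tails/idP => [[//|[u]]|]; [rewrite inE | left].
(* The sink [s] is a row but not a column, so its row contains no diagonal entry, and its
   predecessor [c] is a column. *)
have [c [s [csA sA]]] := sink_exists He arcA nA.
have [arcP inA outA] := arcA; have [ecs cM sM scA] := arcP _ _ csA.
have esc : e s c by rewrite (tree_sym He).
have cs := tree_neq He ecs.
have stail : s \notin tails M A.
  by apply/in_tails => -[|[t]]; [apply/negP | apply/negP].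
have /imsetP[i _ fi] : s \in f @: 'I_j by rewrite fA; apply/in_heads; right; exists c.
have /imsetP[b0 _ gb0] : c \in g @: 'I_j by rewrite gA; apply/in_tails; right; exists s.
have gs b : g b != s.
  by apply: contraNneq stail => <-; rewrite -gA imset_f.
have step : minor e f g =
    - ((-1) ^+ (i + b0) * minor e (f \o lift i) (g \o lift b0)).
  rewrite (minor_expand _ _ _ i) (bigD1 b0) //= -fi -gb0 gen_laplacian_edge //.
  rewrite mulN1r big1 ?addr0 // => b bb0.
  have [->|/gen_laplacian_neq0[sg|esg]] := eqVneq (gen_laplacian e s (g b)) 0.
  - by rewrite mul0r.
  - by move: (gs b); rewrite -sg eqxx.
  pose B := branch e s c.
  have sB : s \notin B by apply/negP => /(branch_neq cs); rewrite eqxx.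
  have gbB : g b \notin B.
    apply/negP => gbB; have := tree_branch_inj He esc esg gbB.
    by rewrite gb0 => /injg b0b; rewrite b0b eqxx in bb0.
  rewrite [X in _ * (_ * X)](minor_block0 (B := B)) ?mulr0 //.
  - exact: inj_lift.
  - exact: inj_lift.
  (* With row [s] deleted and [s] not among the columns, a nonzero entry cannot link [B] to its
     complement: every tree edge leaving [B] ends at [s]. *)
  - move=> x y /= /gen_laplacian_neq0[->//|exy].
    have fxs : f (lift i x) != s by rewrite fi (inj_eq injf) eq_sym neq_lift.
    have gys := gs (lift b y).
    apply/idP/idP => [fB|gB]; [apply: branch_step fB _ | apply: branch_step gB _].
      by rewrite /off /= exy fxs gys.
    by rewrite /off /= (tree_sym He) exy fxs gys.
  rewrite !imset_lift // -fi fA gA.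
  have -> : (heads M A :\ s) :&: B = heads M A :&: B.
    by apply/setP => x; rewrite !in_setI in_setD1; case: eqP => // ->;
      rewrite (negPf sB) !andbF.
  have -> : (tails M A :\ g b) :&: B = tails M A :&: B.
    by apply/setP => x; rewrite !in_setI in_setD1; case: eqP => // ->;
      rewrite (negPf gbB) !andbF.
  rewrite (card_heads_setI _ arcA) (card_tails_setI _ arcA).
  (* The arc [(c, s)] is the only one leaving [B] and none enters it, so [B] holds one more column
     than rows. *)
  have -> : [set a in A | a.1 \in B] = (c, s) |: [set a in A | a.2 \in B].
    apply/setP => -[x y]; rewrite in_setU1 [LHS]inE [in RHS]inE /=.
    have [|xyA] := boolP ((x, y) \in A) => /=; last first.
      by rewrite orbF; apply/esym; apply: contraNF xyA => /eqP->.
    move=> xyA; have [exy _ _ _] := arcP _ _ xyA.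
    have [[xc ys]|xycs] := eqVneq (x, y) (c, s).
      by rewrite xc branch_refl.
    have xs : x != s by apply: contraNneq (sA y) => <-.
    have ys : y != s.
      by apply: contraNneq xycs => ys; rewrite ys in xyA *; rewrite (inA _ _ _ xyA csA).
    rewrite /=; apply/idP/idP => [xB|yB].
      by apply: branch_step xB _; rewrite /off /= exy xs ys.
    by apply: branch_step yB _; rewrite /off /= (tree_sym He) exy xs ys.
  rewrite cardsU1 inE /= (negPf sB) andbF /= eqn_add2l add1n.
  by rewrite neq_ltn ltnSn.
apply: (@eq_sign_trans _ _ (minor e (f \o lift i) (g \o lift b0))).
  by exists (i + b0).+1; rewrite step exprS -mulrA mulN1r.
apply: (IHk (A :\ (c, s))) => //.
- by rewrite (cardsD1 (c, s)) csA in ltk.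
- split=> [x y|x y z|x y z]; rewrite ?in_setD1 => /andP[_ xyA].
  + by have [? ? ? yxA] := arcP _ _ xyA; split=> //; rewrite (negPf yxA) andbF.
  + by move=> /andP[_]; apply: inA.
  + by move=> /andP[_]; apply: outA.
- exact: inj_lift.
- exact: inj_lift.
- rewrite imset_lift // -fi fA; apply/setP => x; rewrite in_setD1.
  apply/andP/in_heads => [[xs /in_heads[|[u ux]]]|[xM|[u]]]; [by left| |split|].
  + by right; exists u; rewrite in_setD1 ux andbT; apply: contraNneq xs => -[_ ->].
  + by apply: contraNneq sM => <-.
  + by apply/in_heads; left.
  + rewrite in_setD1 => /andP[uxcs uxA]; split; last by apply/in_heads; right; exists u.
    by apply: contraNneq uxcs => xs; rewrite xs in uxA *; rewrite (inA _ _ _ uxA csA).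
- rewrite imset_lift // -gb0 gA; apply/setP => x; rewrite in_setD1.
  apply/andP/in_tails => [[xc /in_tails[|[u ux]]]|[xM|[u]]]; [by left| |split|].
  + by right; exists u; rewrite in_setD1 ux andbT; apply: contraNneq xc => -[-> _].
  + by apply: contraNneq cM => <-.
  + by apply/in_tails; left.
  + rewrite in_setD1 => /andP[uxcs uxA]; split; last by apply/in_tails; right; exists u.
    by apply: contraNneq uxcs => xc; rewrite xc in uxA *; rewrite (outA _ _ _ uxA csA).
Qed.

(** Induction on the size. If rows and columns form the same set, take every vertex as a loop.
    Otherwise expand along a row vertex that is not a column: some term has a nonzero entry and a
    nonzero cofactor, the entry is a tree edge, and it extends the arc system of the cofactor. *)
Lemma minor_neq0_arc_system n (e : rel 'I_n) j (f g : 'I_j -> 'I_n) :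
  is_tree e -> injective f -> injective g -> minor e f g != 0 ->
  exists M A, [/\ arc_system e M.1 A, f @: 'I_j = heads M A & g @: 'I_j = tails M A].
Proof.
move=> He; elim: j f g => [|j IHj] f g injf injg nz.
  exists (set0, set0), set0; split; first by split=> [u v|u u' v|u v v']; rewrite inE.
    apply/setP => x; apply/imsetP/in_heads => [[[]]//|[|[u]]]; by rewrite inE.
  by apply/setP => x; apply/imsetP/in_tails => [[[]]//|[|[u]]]; rewrite inE.
have [fg|] := boolP (f @: 'I_j.+1 \subset g @: 'I_j.+1).
  have {}fg : f @: 'I_j.+1 = g @: 'I_j.+1.
    by apply/eqP; rewrite eqEcard fg (card_imset _ injf) (card_imset _ injg) leqnn.
  exists (f @: 'I_j.+1, set0), set0; split.
  - by split=> [u v|u u' v|u v v']; rewrite inE.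
  - by apply/setP => x; apply/idP/in_heads => [|[//|[u]]]; [left | rewrite inE].
  - by rewrite -fg; apply/setP => x; apply/idP/in_tails => [|[//|[u]]];
      [left | rewrite inE].
case/subsetPn=> _ /imsetP[i _ ->] fig.
have [b Lb nzb] : exists2 b, gen_laplacian e (f i) (g b) != 0 &
    minor e (f \o lift i) (g \o lift b) != 0.
  have [/existsP[b /andP[? ?]]|/existsPn no] :=
    boolP [exists b, (gen_laplacian e (f i) (g b) != 0)
                  && (minor e (f \o lift i) (g \o lift b) != 0)]; first by exists b.
  case/eqP: nz; rewrite (minor_expand _ _ _ i) big1 // => b _.
  by have := no b; rewrite negb_and !negbK => /orP[]/eqP->; rewrite ?mul0r ?mulr0.
have fgb : f i != g b by apply: contraNneq fig => ->; rewrite imset_f.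
have eig : e (f i) (g b).
  by case/gen_laplacian_neq0: Lb => // /eqP; rewrite (negPf fgb).
have [M [A [arcA fA gA]]] := IHj _ _ (inj_lift (i := i) injf) (inj_lift (i := b) injg) nzb.
have {}fA := etrans (esym (imset_lift i injf)) fA.
have {}gA := etrans (esym (imset_lift b injg)) gA.
have fiH : f i \notin heads M A by rewrite -fA in_setD1 eqxx.
have gbT : g b \notin tails M A by rewrite -gA in_setD1 eqxx.
have fiT : f i \notin tails M A by rewrite -gA in_setD1 (negPf fig) andbF.
have [arcP inA outA] := arcA.
(* Rows are heads and columns are tails, so the new arc runs from [g b] to [f i]; it ends its path
   because [f i] is not a tail. *)
exists M, ((g b, f i) |: A); split.
- split.
  + move=> u v; rewrite in_setU1 => /orP[/eqP[-> ->]|uvA].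
      split.
      * by rewrite (tree_sym He).
      * by apply: contra gbT => gM; apply/in_tails; left.
      * by apply: contra fiH => fM; apply/in_heads; left.
      rewrite in_setU1 negb_or; apply/andP; split.
        by apply: contraNneq fgb => -[-> _].
      by apply: contra fiT => fA'; apply/in_tails; right; exists (g b).
    have [euv uM vM vuA] := arcP _ _ uvA; split=> //.
    rewrite in_setU1 (negPf vuA) orbF; apply: contraNneq fiT => -[_ uf].
    by apply/in_tails; right; exists v; rewrite -uf.
  + move=> u u' v; rewrite !in_setU1 => /orP[/eqP[ug vf]|uvA] /orP[/eqP[u'g vf']|u'vA].
    * by rewrite ug u'g.
    * by case/negP: fiH; apply/in_heads; right; exists u'; rewrite -vf.
    * by case/negP: fiH; apply/in_heads; right; exists u; rewrite -vf'.
    * exact: inA uvA u'vA.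
  + move=> u v v'; rewrite !in_setU1 => /orP[/eqP[ug vf]|uvA] /orP[/eqP[ug' vf']|uv'A].
    * by rewrite vf vf'.
    * by case/negP: gbT; apply/in_tails; right; exists v'; rewrite -ug.
    * by case/negP: gbT; apply/in_tails; right; exists v; rewrite -ug'.
    * exact: outA uvA uv'A.
- have fiI : f i \in f @: 'I_j.+1 by apply: imset_f.
  rewrite -(setD1K fiI) fA.
  apply/setP => x; rewrite in_setU1; apply/orP/in_heads.
    case=> [/eqP->|/in_heads[|[u ux]]]; [right|by left|right].
      by exists (g b); rewrite setU11.
    by exists u; rewrite in_setU1 ux orbT.
  case=> [xM|[u]]; first by right; apply/in_heads; left.
  rewrite in_setU1 => /orP[/eqP[_ ->]|ux]; first by left.
  by right; apply/in_heads; right; exists u.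
- have gbI : g b \in g @: 'I_j.+1 by apply: imset_f.
  rewrite -(setD1K gbI) gA.
  apply/setP => x; rewrite in_setU1; apply/orP/in_tails.
    case=> [/eqP->|/in_tails[|[u ux]]]; [right|by left|right].
      by exists (f i); rewrite setU11.
    by exists u; rewrite in_setU1 ux orbT.
  case=> [xM|[u]]; first by right; apply/in_tails; left.
  rewrite in_setU1 => /orP[/eqP[-> _]|ux]; first by left.
  by right; apply/in_tails; right; exists u.
Qed.

(** * Reduction to minimal 2-matchings *)

Lemma principal_in_ideal n (e : rel 'I_n) (W : {set 'I_n}) u S :
  is_tree e -> u \in W -> in_ideal S (principal e (W :\ u)) ->
  (forall v, v \in W -> e u v -> in_ideal S (principal e (W :\ u :\ v))) ->
  in_ideal S (principal e W).
Proof.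
move=> He uW SWu SWuv; pose f := @enum_val _ (mem W).
have injf : injective f by apply: enum_val_inj.
have fW : f @: 'I_#|W| = W.
  apply/setP => x; apply/imsetP/idP => [[a _ ->]|xW]; first exact: enum_valP.
  by exists (enum_rank_in xW x); rewrite /f ?enum_rankK_in.
have /imsetP[i _ ui] : u \in f @: 'I_#|W| by rewrite fW.
rewrite /principal -/f (minor_expand _ _ _ i) -ui; apply: in_ideal_sum => b _.
have [->|/gen_laplacian_neq0[ub|eub]] := eqVneq (gen_laplacian e u (f b)) 0.
- by rewrite mul0r; apply: in_ideal0.
- do 2![apply: in_idealM]; apply: in_ideal_sign SWu; apply: minor_principal.
  + exact: inj_lift.
  + exact: inj_lift.
  + by rewrite imset_lift // fW -ui.
  + by rewrite imset_lift // fW -ub.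
have fbW : f b \in W by apply: enum_valP.
have ufb := tree_neq He eub.
do 2![apply: in_idealM]; apply: in_ideal_sign (SWuv _ fbW eub).
(* This cofactor has rows [W :\ u] and columns [W :\ f b]: they are the heads and tails of the
   single arc [(u, f b)] together with loops on the remaining vertices. *)
pose M : matching n := (W :\ u :\ f b, set0).
apply: (@minor_arc_system _ _ M [set (u, f b)]) => //.
- split=> [x y|x y z|x y z]; rewrite !in_set1.
  + move=> /eqP[-> ->]; rewrite !in_setD1 !eqxx /= andbF; split=> //.
    by apply: contraNneq ufb => -[-> _].
  + by move=> /eqP[-> _] /eqP[-> _].
  + by move=> /eqP[_ ->] /eqP[_ ->].
- exact: inj_lift.
- exact: inj_lift.
- rewrite imset_lift // fW -ui; apply/setP => x; apply/idP/in_heads => [xWu|].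
    have [->|xb] := eqVneq x (f b); [right|left].
      by exists u; rewrite in_set1.
    by rewrite in_setD1 xb.
  case=> [|[y]]; first by rewrite /= in_setD1 => /andP[].
  by rewrite in_set1 => /eqP[_ ->]; rewrite in_setD1 eq_sym ufb.
- rewrite imset_lift // fW; apply/setP => x; apply/idP/in_tails => [|].
    rewrite in_setD1 => /andP[xb xW].
    have [->|xu] := eqVneq x u; [right|left].
      by exists (f b); rewrite in_set1.
    by rewrite !in_setD1 xb xu.
  case=> [|[y]]; first by rewrite /= !in_setD1 => /and3P[-> _ ->].
  by rewrite in_set1 => /eqP[-> _]; rewrite in_setD1 ufb.
Qed.

Lemma subset_of_card (T : finType) (A : {set T}) k :
  (k <= #|A|)%N -> exists2 B : {set T}, B \subset A & #|B| = k.
Proof.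
move=> kA; exists [set x in take k (enum A)].
  by apply/subsetP => x; rewrite inE => /mem_take; rewrite mem_enum.
rewrite cardsE (card_uniqP _) ?take_uniq ?enum_uniq // size_takel //.
by rewrite -cardE.
Qed.

(** The forest [Q] has degree 0 at [v] and at most 1 at [u], which leaves room for the edge [uv]. *)
Lemma linear_forest_edge n (e : rel 'I_n) (W : {set 'I_n}) (u v : 'I_n) Q :
  is_tree e -> e u v -> v \in W -> linear_forest e (W :\ u) Q -> (deg Q u <= 1)%N ->
  linear_forest e (W :\ u :\ v) ([set u; v] |: Q) /\ #|[set u; v] |: Q| = #|Q|.+1.
Proof.
move=> He euv vW lfQ dQu; have [QT dQ QW] := lfQ.
have vWu : v \in W :\ u by rewrite in_setD1 eq_sym (tree_neq He euv).
have uvQ : [set u; v] \notin Q.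
  by apply/negP => /(linear_forest_avoid lfQ)/(_ (set22 _ _)); rewrite vWu.
split; last by rewrite cardsU1 uvQ.
split=> [|x|E].
- by rewrite subUset QT sub1set andbT; apply/tree_edgesP; exists u, v.
- apply: leq_trans (deg_setU1 _ _ _) _; rewrite in_set2.
  have [->|xu] := eqVneq x u; first by rewrite add1n.
  have [->|xv] /= := eqVneq x v; last exact: dQ.
  by rewrite (linear_forest_deg0 lfQ vWu).
rewrite in_setU1 => /orP[/eqP->|/QW EW].
  by apply/subsetP => x; rewrite in_set2 !inE => /orP[]/eqP->; rewrite eqxx ?andbF.
by apply: subset_trans EW _; rewrite setCS subsetDl.
Qed.

(** The bounds on [j] allow [P] to have surplus edges, because removing one or two loops from [W]
    may leave more edges than size [j] requires. *)
Lemma principal_min_2matching n (e : rel 'I_n) (S : {mpoly int[n]} -> Prop) j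
    (W : {set 'I_n}) P :
  is_tree e ->
  (forall M, is_min_2matching e j M -> in_ideal S (principal e M.1)) ->
  linear_forest e W P -> (#|W| <= j <= #|W| + #|P|)%N -> in_ideal S (principal e W).
Proof.
move=> He minS; have [k] := ubnP #|W|.
elim: k W P => // k IHk W P ltk lfP /andP[Wj jWP].
(* Discard surplus edges so that the 2-matching has size exactly [j]. *)
have [P0 P0P cP0] : exists2 P0 : {set {set 'I_n}}, P0 \subset P & #|P0| = (j - #|W|)%N.
  by apply: subset_of_card; rewrite leq_subLR.
have {P P0P jWP}lfP := linear_forest_sub P0P lfP.
have lfM : is_2matching e (W, P0) by apply/is_2matchingE.
have sM : Defs.msize (W, P0) = j by rewrite /Defs.msize /= cP0 subnKC.
have [[[W' P'] [/is_2matchingE lfP' [sM' W'W]]]|noM] :=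
  Classical_Prop.classic (exists M', is_2matching e M' /\
    Defs.msize M' = Defs.msize (W, P0) /\ M'.1 \proper (W, P0).1);
  last by apply: (minS (W, P0)).
rewrite sM /Defs.msize /= in sM' W'W lfP'.
have cW := cardsD W W'; have cW' := proper_card W'W.
rewrite (setIidPr (proper_sub W'W)) in cW.
(* Both 2-matchings have size [j], so each loop saved by [W'] is replaced by an edge of [P']. *)
have leP : (#|P0| + #|W :\: W'| <= #|P'|)%N.
  by rewrite cW cP0 -(leq_add2l #|W'|) sM' addnCA subnKC ?subnK // ltnW.
have [u [Q [uW lfQ dQ ltQ]]] := augment He W'W lfP lfP' leP.
have cWu := cardsD1 u W; rewrite uW in cWu; rewrite cP0 in ltQ.
apply: (principal_in_ideal He uW) => [|v vW euv].
  (* The extra edge of [Q] compensates for the lost loop at [u]; below, the edge [uv] likewise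
     compensates for the lost loop at [v]. *)
  by apply: IHk lfQ _; lia.
have [lfQ' cQ'] := linear_forest_edge He euv vW lfQ dQ.
have cWuv := cardsD1 v (W :\ u).
rewrite in_setD1 vW eq_sym (tree_neq He euv) /= in cWuv.
rewrite cWu cWuv in ltk ltQ Wj.
by apply: IHk lfQ' _; rewrite ?cQ'; move: ltk ltQ Wj; move: #|W :\ u :\ v| => w; lia.
Qed.

(** * Minors with increasing indices and equality of the two ideals *)

Lemma enum_val_ltn n (A : {set 'I_n}) : {homo @enum_val _ (mem A) : a b / (a < b)%N}.
Proof.
move=> a b ab; have srt : sorted ltn (map val (enum A)).
  rewrite /enum_mem -enumT; apply: (subseq_sorted ltn_trans).
    exact/map_subseq/filter_subseq.
  by rewrite val_enum_ord iota_ltn_sorted.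
have x0 := enum_val a.
rewrite !(enum_val_nth x0) -!(nth_map x0 0%N val) -?cardE //.
by apply: (sorted_ltn_nth ltn_trans) => //; rewrite inE size_map -cardE.
Qed.

Lemma homo_ltn_inj n j (f : 'I_j -> 'I_n) :
  {homo f : a b / (a < b)%N} -> injective f.
Proof.
move=> hf a b fab; apply/eqP; rewrite -val_eqE /= eqn_leq leqNgt [X in _ && X]leqNgt.
by apply/andP; split; apply/negP => /hf; rewrite fab ltnn.
Qed.

Lemma subdet_minor n (e : rel 'I_n) j (A B : {set 'I_n}) :
  #|A| = j -> #|B| = j -> exists f g : 'I_j -> 'I_n,
  [/\ {homo f : a b / (a < b)%N}, {homo g : a b / (a < b)%N}, f @: 'I_j = A, g @: 'I_j = B
    & subdet (gen_laplacian e) A B = minor e f g].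
Proof.
move=> Aj Bj; subst j; have imE (D : {set 'I_n}) : (@enum_val _ (mem D)) @: 'I_#|D| = D.
  apply/setP => x; apply/imsetP/idP => [[a _ ->]|xD]; first exact: enum_valP.
  by exists (enum_rank_in xD x); rewrite ?enum_rankK_in.
exists (@enum_val _ (mem A)), (fun b => @enum_val _ (mem B) (cast_ord (esym Bj) b)).
split.
- exact: enum_val_ltn.
- by move=> a b ab; apply: enum_val_ltn.
- exact: imE.
- apply/setP => x; rewrite -[in RHS](imE B); apply/imsetP/imsetP => [[b _ ->]|[b _ ->]].
    by exists (cast_ord (esym Bj) b).
  by exists (cast_ord Bj b); rewrite // cast_ordK.
(* Since [A] and [B] have equal cardinals, the default value of [nth] in [subdet] is never
   reached. *)
by congr (\det _); apply/matrixP => a b; rewrite [LHS]mxE [RHS]mxE;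
  congr (gen_laplacian e _ _); rewrite [RHS](enum_val_nth (enum_val a)).
Qed.

Lemma dpoly_sign n (e : rel 'I_n) (M : matching n) (A : {set 'I_n * 'I_n}) :
  eq_sign (dpoly e M A) (subdet (gen_laplacian e) (heads M A) (tails M A)).
Proof.
rewrite /dpoly; case: ifP => _; first by exists 0%N; rewrite mul1r.
by exists 1%N; rewrite mulN1r.
Qed.

Theorem theorem3p6 (n : nat) (e : rel 'I_n) (He : is_tree e)
  (orient : matching n -> {set 'I_n * 'I_n})
  (Horient : forall M : matching n, is_2matching e M -> is_orientation M (orient M))
  (j : nat) (Hj : (1 <= j <= n)%N) :
  forall p : {mpoly int[n]},
    critical_ideal e j p <->
    in_ideal (fun q => exists M : matching n,
                 is_min_2matching e j M /\ q = dpoly e M (orient M)) p.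
Proof.
(* Up to sign, each generator is both a minor of size [j] with increasing indices, as one inclusion
   requires, and the principal minor on the loops, as the other requires. *)
have minor_dpoly M : is_min_2matching e j M -> exists f g : 'I_j -> 'I_n,
    [/\ {homo f : a b / (a < b)%N}, {homo g : a b / (a < b)%N},
      eq_sign (dpoly e M (orient M)) (minor e f g)
      & eq_sign (minor e f g) (principal e M.1)].
  case=> MP [Mj _]; have orM := Horient _ MP.
  have arcM := orientation_arc_system He MP orM.
  have cA : (#|M.1| + #|orient M|)%N = j.
    by rewrite -(card_undirected arcM) (undirected_orientation He MP orM).
  have [|| f [g [hf hg fH gT fg]]] := @subdet_minor _ e j (heads M (orient M)) (tails M (orient M)).
  - by rewrite (card_heads arcM).
  - by rewrite (card_tails arcM).
  exists f, g; split=> //; first by rewrite -fg; apply: dpoly_sign.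
  by apply: (minor_arc_system He arcM) fH gT; apply: homo_ltn_inj.
move=> p; split; apply: in_ideal_trans => q.
  case=> f [g [/homo_ltn_inj injf [/homo_ltn_inj injg ->]]]; rewrite -/(minor e f g).
  have [->|nz] := eqVneq (minor e f g) 0; first exact: in_ideal0.
  have [M [A [arcA fA gA]]] := minor_neq0_arc_system He injf injg nz.
  apply: in_ideal_sign (minor_arc_system He arcA injf injg fA gA) _.
  apply: (principal_min_2matching (j := j) He _ (arc_system_forest He arcA)).
    move=> M' minM'; have [f' [g' [_ _ sd sp]]] := minor_dpoly M' minM'.
    apply: in_ideal_sign (eq_sign_sym (eq_sign_trans sd sp)) _.
    by apply: in_ideal_gen; exists M'.
  (* Loops and arcs together number [j], the number of rows. *)
  rewrite (card_undirected arcA) -(card_heads arcA) -fA card_imset // card_ord leqnn.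
  by rewrite andbT -[leqRHS]card_ord -(card_imset _ injf) fA (card_heads arcA) leq_addr.
case=> M [minM ->]; have [f [g [hf hg sd _]]] := minor_dpoly M minM.
by apply: in_ideal_sign sd _; apply: in_ideal_gen; exists f, g.
Qed.
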